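(* Let $\Omega\subset\mathbb{C}$ be a Jordan domain, let $F:\mathbb{D}\to\Omega$ be a biholomorphism (extended to a homeomorphism $\overline{\mathbb{D}}\to\overline{\Omega}$), and let $a\in\partial\Omega$. The geodesic-preserving functions of $\mathfrak{G}^{\Omega}_a$, i.e. the elements $f$ of $GP(\mathfrak{G}^{\Omega}_a,\mathfrak{G}^{\Omega}_a)$, are exactly the functions $$f=F\circ g\circ F^{-1},\qquad g\in GP(\mathfrak{G}^{\mathbb{D}}_{F^{-1}(a)},\mathfrak{G}^{\mathbb{D}}_{F^{-1}(a)}).$$
   Context: $\mathbb{D}$ is the open unit disc. A Jordan domain is the interior of a Jordan curve in the plane. The Kobayashi metric on $\Omega$ is $k_\Omega(z,w)=k_{\mathbb{D}}(F^{-1}(z),F^{-1}(w))$, where $k_{\mathbb{D}}$ is the Poincaré metric. A geodesic in a domain is a curve that is length-minimizing for the Kobayashi metric between any two of its points; a geodesic line is a geodesic defined on all of $\mathbb{R}$ whose limits at $\pm\infty$ lie on the boundary of the domain; the geodesic lines of $\Omega$ are the images under $F$ of the geodesic lines of $\mathbb{D}$. Geodesics are identified with their images. For a point $a$ in the closure of the domain $\Omega$ (or $\mathbb{D}$), $\mathfrak{G}^{\Omega}_a$ (or $\mathfrak{G}^{\mathbb{D}}_a$) is the family of all images $\gamma$ of geodesic lines in the domain with $a\in\overline{\gamma}$. Given families $\mathfrak{F}_1,\mathfrak{F}_2$ of geodesics in domains $\Omega_1,\Omega_2$, $GP(\mathfrak{F}_1,\mathfrak{F}_2)$ is the set of holomorphic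 maps $f:\Omega_1\to\Omega_2$ such that for every $\gamma_1\in\mathfrak{F}_1$ there is $\gamma_2\in\mathfrak{F}_2$ with $f(\gamma_1)\subset\gamma_2$. *)

(* Defs.v *)
(* The complex plane is R[i] for an arbitrary R : realType. *)
From HB Require Import structures.
From mathcomp Require Import all_boot all_order all_algebra.
From mathcomp Require Import all_classical all_reals all_analysis.
From mathcomp Require Import complex.

Set Implicit Arguments.
Unset Strict Implicit.
Unset Printing Implicit Defensive.

Import Order.TTheory GRing.Theory Num.Theory.
Import numFieldNormedType.Exports.

Local Open Scope classical_set_scope.
Local Open Scope ring_scope.

(* The library puts no topology on R[i]; this gives it the one induced by its
   norm as a numFieldType, together with its structure of one-dimensional
   normed module over itself. *)
HB.instance Definition _ (R : rcfType) := NormedModule.copy R[i] R[i]^o.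

Definition boundary (T : topologicalType) (A : set T) : set T :=
  closure A `\` A°.

Definition unit_disc (R : realType) : set R[i] := [set z | `|z| < 1].

Definition unit_circle (R : realType) : set R[i] := [set z | `|z| = 1].

Definition jordan_curve (R : realType) (J : set R[i]) : Prop :=
  exists c : R[i] -> R[i],
    [/\ {within @unit_circle R, continuous c},
        set_inj (@unit_circle R) c &
        J = c @` @unit_circle R].

(* The interior of a Jordan curve is the bounded connected component of its
   complement. *)
Definition jordan_domain (R : realType) (Omega : set R[i]) : Prop :=
  exists (J : set R[i]) (z : R[i]),
    [/\ jordan_curve J, ~ J z,
        Omega = connected_component (~` J) z & bounded_set Omega].

(* Maps between subsets of the plane are total functions on R[i] of which only
   the restriction to the source matters.  As the increments range over R[i],
   [derivable f z 1] is complex differentiability. *)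
Definition holomorphic_on (R : realType) (U : set R[i]) (f : R[i] -> R[i]) :
    Prop :=
  forall z, U z -> derivable f z 1.

Definition inv_on (R : realType) (A : set R[i]) (f : R[i] -> R[i]) :
    R[i] -> R[i] :=
  'pinv_(fun=> 0) A f.

Definition biholomorphism (R : realType) (U V : set R[i])
    (F : R[i] -> R[i]) : Prop :=
  [/\ set_bij U V F, holomorphic_on U F & holomorphic_on V (inv_on U F)].

Definition homeomorphism_on (R : realType) (A B : set R[i])
    (F : R[i] -> R[i]) : Prop :=
  [/\ set_bij A B F, {within A, continuous F} &
      {within B, continuous (inv_on A F)}].

(* Distance of the metric |dz| / (1 - |z|^2) of curvature -4; only its values
   on the unit disc are meaningful. *)
Definition poincare (R : realType) (z w : R[i]) : R :=
  let d := complex.Re `|(z - w) / (1 - w^* * z)| in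
  2^-1 * ln ((1 + d) / (1 - d)).

(* F is a biholomorphism from the unit disc; only the values on its image are
   meaningful. *)
Definition kobayashi (R : realType) (F : R[i] -> R[i]) (z w : R[i]) : R :=
  poincare (inv_on (@unit_disc R) F z) (inv_on (@unit_disc R) F w).

Definition curve_length (R : realType) (k : R[i] -> R[i] -> R)
    (gamma : R -> R[i]) (s t : R) : \bar R :=
  ereal_sup
    [set (\sum_(0 <= n < size l)
            k (gamma (nth t (s :: l) n)) (gamma (nth t (s :: l) n.+1)))%:E
    | l in itv_partition s t].

Definition curve_from_to (R : realType) (U : set R[i]) (p q : R[i])
    (c : R -> R[i]) : Prop :=
  [/\ {within `[0, 1], continuous c}, c @` `[0, 1] `<=` U, c 0 = p & c 1 = q].

Definition geodesic (R : realType) (U : set R[i]) (k : R[i] -> R[i] -> R)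
    (I : interval R) (gamma : R -> R[i]) : Prop :=
  [/\ {within [set` I], continuous gamma},
      gamma @` [set` I] `<=` U &
      forall s t, s \in I -> t \in I -> s <= t ->
        forall c, curve_from_to U (gamma s) (gamma t) c ->
          (curve_length k gamma s t <= curve_length k c 0 1)%E].

Definition geodesic_line (R : realType) (U : set R[i])
    (k : R[i] -> R[i] -> R) (gamma : R -> R[i]) : Prop :=
  [/\ geodesic U k `]-oo, +oo[ gamma,
      exists2 p, boundary U p & gamma t @[t --> -oo] --> p &
      exists2 q, boundary U q & gamma t @[t --> +oo] --> q].

Definition geodesics_at (R : realType) (U : set R[i])
    (k : R[i] -> R[i] -> R) (a : R[i]) : set (set R[i]) :=
  [set A | exists gamma : R -> R[i],
     [/\ geodesic_line U k gamma, A = range gamma & closure A a]].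

Definition GP (R : realType) (U V : set R[i]) (FF1 FF2 : set (set R[i])) :
    set (R[i] -> R[i]) :=
  [set f | [/\ holomorphic_on U f, f @` U `<=` V &
     forall A, FF1 A -> exists2 B, FF2 B & f @` A `<=` B]].

(* Main.v *)
Require Import Defs.
From HB Require Import structures.
From mathcomp Require Import all_boot all_order all_algebra.
From mathcomp Require Import all_classical all_reals all_analysis.
From mathcomp Require Import complex lra.

Set Implicit Arguments.
Unset Strict Implicit.
Unset Printing Implicit Defensive.

Import Order.TTheory GRing.Theory Num.Theory.
Import numFieldNormedType.Exports.

Local Open Scope classical_set_scope.
Local Open Scope ring_scope.

(** The metric of [Omega] is by definition the Poincare metric pulled back along
    [F], so [F] is at once a biholomorphism and an isometry: it carries lengths
    of curves, hence length-minimizing curves, from the disc to [Omega], and its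
    inverse carries them back.  What is not metric in the notion of a geodesic
    line is the requirement that its ends converge to boundary points, and in
    the family of geodesics at [a] the requirement that [a] be a limit point.
    Both are preserved because [F] is a homeomorphism of the closures that
    matches the open domains, and therefore matches the boundaries.  So [F]
    sends the geodesics at [F^-1 a] to geodesics at [a], the inverse does the
    opposite ([geodesics_at_image]), and conjugation by [F] exchanges the two
    classes of geodesic-preserving maps ([GP_conjugate]).

    The Jordan hypothesis enters only through the openness of [Omega]
    ([jordan_domain_open]).  Openness identifies the boundary, which is the
    closure minus the interior, with the closure minus [Omega] itself, and it
    makes holomorphy on [Omega] depend only on the values taken in [Omega].  It
    holds because a Jordan curve is compact, hence closed, and the plane is
    locally connected, so that the components of the complement are open.

    As the two directions of the argument are the same up to exchanging [F] and
    its inverse, everything is stated for a [conformal_isometry] between two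
    arbitrary sets of the plane, and then applied to both maps. *)

(** * Jordan domains are open *)

Lemma real_complex_continuous (R : realType) :
  continuous (fun t : R => (t%:C)%C : R[i]).
Proof.
move=> x; apply/(@cvgrPdist_lt R[i] R[i]) => e e0.
have eE : e = ((complex.Re e)%:C)%C by rewrite RRe_real// ger0_real// ltW.
have Re0 : 0 < complex.Re e by rewrite -ltcR -eE.
near=> y.
rewrite -rmorphB/= normc_def/= expr0n/= addr0 sqrtr_sqr eE ltcR.
near: y.
exact: (@cvgr_dist_lt _ _ _ _ _ id).
Unshelve. all: by end_near. Qed.

Lemma unit_circle_compact (R : realType) : compact (@unit_circle R).
Proof.
pose p (z : R * R) : R[i] := (z.1%:C)%C + 'i%C * (z.2%:C)%C.
have p_cont : continuous p.
  move=> z; apply: cvgD.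
    by apply: continuous_comp; [exact: cvg_fst|exact: real_complex_continuous].
  apply: cvgM; first exact: cvg_cst.
  by apply: continuous_comp; [exact: cvg_snd|exact: real_complex_continuous].
have sqC : compact (p @` (`[-1, 1] `*` `[-1, 1])).
  apply: continuous_compact; first exact: continuous_subspaceT.
  by apply: compact_setX; exact: segment_compact.
apply: subclosed_compact sqC _.
  rewrite (_ : @unit_circle R = (fun z : R[i] => `|z|) @^-1` [set (1 : R[i])])//.
  apply: preimage_closed; last first.
    exact/accessible_closed_set1/hausdorff_accessible/norm_hausdorff.
  by move=> z _; exact: (@norm_continuous R[i] R[i]).
move=> z z1; exists (complex.Re z, complex.Im z); last first.
  by rewrite /p/= [RHS]complexE.
have Rez : complex.Re z ^+ 2 + complex.Im z ^+ 2 = 1.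
  move: z1; rewrite /unit_circle/= normc_def => -[] /(congr1 (fun t => t ^+ 2)).
  by rewrite sqr_sqrtr ?expr1n// addr_ge0 ?sqr_ge0.
by split; rewrite /= in_itv/=; apply/andP; split; nra.
Qed.

(** A ball is the union of the segments joining its centre to its points. *)
Lemma ball_connected (R : realType) (z e : R[i]) : connected (ball z e).
Proof.
pose seg (w : R[i]) (t : R) : R[i] := z + (t%:C)%C * (w - z).
have seg_cont w : continuous (seg w).
  move=> t; apply: cvgD; first exact: cvg_cst.
  by apply: cvgM; [exact: real_complex_continuous|exact: cvg_cst].
(* [e] is a complex number, so it may fail to be positive or even real; the
   ball is empty in both cases. *)
have [e0|/negP e0] := boolP (0 < e); last first.
  rewrite (_ : ball z e = set0); first exact: connected0.
  rewrite -subset0 => w /=; rewrite -ball_normE/= => zw.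
  by apply: e0; exact: le_lt_trans zw.
have -> : ball z e = \bigcup_(w in ball z e) (seg w @` `[0, 1]).
  apply/seteqP; split => w /=.
    move=> zw; exists w => //; exists 1; first by rewrite /= in_itv/= lexx ler01.
    by rewrite /seg mul1r addrC subrK.
  move=> [v]; rewrite /= -ball_normE/= => zv [t]; rewrite in_itv/= => /andP[t0 t1].
  move=> <-; rewrite /= /seg opprD addNKr normrN normrM.
  apply: le_lt_trans zv; rewrite [leRHS]distrC ler_piMl//.
  by rewrite ger0_norm ?lecR// ler0c.
apply: bigcup_connected.
  exists z => w _; exists 0; first by rewrite /= in_itv/= lexx ler01.
  by rewrite /seg mul0r addr0.
move=> w _; apply: connected_continuous_connected.
  exact: segment_connected.
exact: continuous_subspaceT.
Qed.

(** A ball around a point of the component that stays in [A] is connected, hence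
    lies in the component. *)
Lemma connected_component_open (R : realType) (A : set R[i]) (z : R[i]) :
  open A -> open (connected_component A z).
Proof.
rewrite !openE => oA w Aw.
have /oA : A w by exact: connected_component_sub Aw.
rewrite /interior => /nbhs_ballP[e e0 weA]; apply/nbhs_ballP; exists e => //.
apply: subset_trans (_ : connected_component A w `<=` _).
  apply: connected_component_max => //; first exact: ballxx.
  exact: ball_connected.
by rewrite (same_connected_component Aw).
Qed.

Lemma jordan_domain_open (R : realType) (Omega : set R[i]) :
  jordan_domain Omega -> open Omega.
Proof.
move=> [J [z [[c [c_cont _ ->]] _ -> _]]].
apply: connected_component_open; rewrite openC.
apply: compact_closed; first exact: norm_hausdorff.
by apply: continuous_compact => //; exact: unit_circle_compact.
Qed.

Lemma unit_disc_open (R : realType) : open (@unit_disc R).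
Proof.
have -> : @unit_disc R = ball (0 : R[i]) 1; last exact: ball_open.
by apply/seteqP; split=> z; rewrite -ball_normE/= sub0r normrN.
Qed.
(** * Transport along maps continuous on a subset *)

Lemma boundary_open (T : topologicalType) (U : set T) :
  open U -> boundary U = closure U `\` U.
Proof. by move=> /interior_id oU; rewrite /boundary oU. Qed.

(** Convergence is transported by [phi] even at a point [p] near which [phi] is
    meaningful on [A] only, such as a boundary point that a geodesic line tends
    to. *)
Lemma cvg_within_comp (T : Type) (X Y : topologicalType) (G : set_system T)
    {FG : Filter G} (A : set X) (u : T -> X) (phi : X -> Y) (p : X) :
  {within A, continuous phi} -> A p -> (\forall t \near G, A (u t)) ->
  u @ G --> p -> (phi \o u) @ G --> phi p.
Proof.
move=> /subspace_continuousP phi_cont Ap Au up.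
apply: cvg_comp (phi_cont p Ap) => W /up.
by apply: filter_app; apply: filterS Au => t At /(_ At).
Qed.

Lemma within_continuous_image (X Y Z : topologicalType) (B : set X)
    (A : set Y) (u : X -> Y) (phi : Y -> Z) :
  {within A, continuous phi} -> u @` B `<=` A -> {within B, continuous u} ->
  {within B, continuous (phi \o u)}.
Proof.
move=> phi_cont uBA /subspace_continuousP u_cont.
apply/subspace_continuousP => x Bx.
apply: (cvg_within_comp phi_cont) (u_cont x Bx); first by apply: uBA; exists x.
by apply: filterS (withinT _ (nbhs_filter x)) => y By; apply: uBA; exists y.
Qed.

Lemma closure_image (X Y : topologicalType) (A B : set X) (phi : X -> Y)
    (x : X) :
  {within B, continuous phi} -> A `<=` B -> B x -> closure A x ->
  closure (phi @` A) (phi x).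
Proof.
move=> /subspace_continuousP phi_cont AB Bx Ax W.
move=> /(phi_cont x Bx)/= /Ax[y [Ay]] /(_ (AB _ Ay)) Wy.
by exists (phi y); split => //; exists y.
Qed.

Lemma holomorphic_on_comp (R : realType) (U V : set R[i])
    (f g : R[i] -> R[i]) :
  holomorphic_on U f -> f @` U `<=` V -> holomorphic_on V g ->
  holomorphic_on U (g \o f).
Proof.
move=> f_holo fUV g_holo z Uz; apply/derivable1_diffP.
apply: differentiable_comp; first exact/derivable1_diffP/f_holo.
by apply/derivable1_diffP/g_holo/fUV; exists z.
Qed.

(** Complex differentiability at a point involves a full neighbourhood, whence
    the openness of [U]. *)
Lemma eq_holomorphic_on (R : realType) (U : set R[i]) (f g : R[i] -> R[i]) :
  open U -> {in U, f =1 g} -> holomorphic_on U f -> holomorphic_on U g.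
Proof.
move=> oU fg f_holo z Uz; apply: near_eq_derivable (f_holo z Uz).
by apply: filterS (open_nbhs_nbhs (conj oU Uz)) => w Uw; apply/fg/mem_set.
Qed.

(** * Conformal isometries and geodesics *)

(** What one of two mutually inverse biholomorphisms has to satisfy in order to
    transport geodesic lines; [k] and [k'] are distances on [U] and [V].
    Bijectivity is left out, so that the inverse of [phi] can be named
    independently as a second total function. *)
Record conformal_isometry (R : realType) (U V : set R[i])
    (k k' : R[i] -> R[i] -> R) (phi : R[i] -> R[i]) : Prop := {
  isometry_continuous : {within closure U, continuous phi};
  isometry_holomorphic : holomorphic_on U phi;
  isometry_image : phi @` U `<=` V;
  isometry_boundary : phi @` boundary U `<=` boundary V;
  isometry_dist : forall x y, U x -> U y -> k' (phi x) (phi y) = k x y }.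

Lemma curve_length_isometry (R : realType) (U V : set R[i])
    (k k' : R[i] -> R[i] -> R) (phi : R[i] -> R[i]) (c : R -> R[i]) (s t : R) :
  conformal_isometry U V k k' phi -> c @` `[s, t] `<=` U ->
  curve_length k' (phi \o c) s t = curve_length k c s t.
Proof.
move=> phiP cU; congr ereal_sup; apply: eq_imagel => l lP.
have mem n : (n < (size l).+1)%N -> U (c (nth t (s :: l) n)).
  move=> ln; apply: cU; exists (nth t (s :: l) n) => //=.
  by rewrite in_itv/= itv_partition_nth_ge// itv_partition_nth_le.
congr EFin; apply: eq_big_nat => n /andP[_ nl].
by apply: (isometry_dist phiP); apply: mem => //; exact: leqW.
Qed.

Section mutually_inverse_isometries.
Context (R : realType) (U V : set R[i]) (k k' : R[i] -> R[i] -> R)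
  (phi psi : R[i] -> R[i]).
Hypotheses (phiP : conformal_isometry U V k k' phi)
  (psiP : conformal_isometry V U k' k psi)
  (phiK : {in U, cancel phi psi}).

(** A competitor of [phi \o gamma] in [V] is pulled back by [psi] to a competitor
    of [gamma] in [U] of the same length. *)
Lemma geodesic_image (I : interval R) (gamma : R -> R[i]) :
  geodesic U k I gamma -> geodesic V k' I (phi \o gamma).
Proof.
move=> [gamma_cont gammaU gamma_min]; split.
- apply: within_continuous_image (isometry_continuous phiP) _ gamma_cont.
  exact: subset_trans gammaU (@subset_closure _ _).
- rewrite -image_comp.
  by apply: subset_trans (isometry_image phiP); exact: image_subset.
- move=> s t sI tI st c [c_cont cV c0 c1].
  have stU : gamma @` `[s, t] `<=` U.
    apply: subset_trans gammaU; apply: image_subset => r.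
    by apply: interval_is_interval.
  have psic : curve_from_to U (gamma s) (gamma t) (psi \o c).
    split.
    + apply: within_continuous_image (isometry_continuous psiP) _ c_cont.
      exact: subset_trans cV (@subset_closure _ _).
    + rewrite -image_comp.
      by apply: subset_trans (isometry_image psiP); exact: image_subset.
    + by rewrite /= c0 /= phiK//; apply/mem_set/gammaU; exists s.
    + by rewrite /= c1 /= phiK//; apply/mem_set/gammaU; exists t.
  rewrite (curve_length_isometry phiP stU) -(curve_length_isometry psiP cV).
  exact: gamma_min psic.
Qed.

Lemma geodesic_line_image (gamma : R -> R[i]) :
  geodesic_line U k gamma -> geodesic_line V k' (phi \o gamma).
Proof.
move=> [geo [p pU gammap] [q qU gammaq]].
have gammaU t : closure U (gamma t).
  by case: geo => _ gammaU _; apply/subset_closure/gammaU; exists t.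
split; first exact: geodesic_image.
- exists (phi p); first by apply: (isometry_boundary phiP); exists p.
  apply: cvg_within_comp (isometry_continuous phiP) _ _ gammap.
    by case: pU.
  exact: nearW.
- exists (phi q); first by apply: (isometry_boundary phiP); exists q.
  apply: cvg_within_comp (isometry_continuous phiP) _ _ gammaq.
    by case: qU.
  exact: nearW.
Qed.

Lemma geodesics_at_image (b : R[i]) (A : set R[i]) :
  geodesics_at U k b A -> geodesics_at V k' (phi b) (phi @` A).
Proof.
move=> [gamma [gammaP -> closb]].
have gammaU : range gamma `<=` U.
  case: gammaP => -[_ gammaU _] _ _.
  by apply: subset_trans gammaU; apply: image_subset.
exists (phi \o gamma); split; first exact: geodesic_line_image.
  by rewrite image_comp.
apply: closure_image (isometry_continuous phiP) _ _ (closb).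
  exact: subset_trans gammaU (@subset_closure _ _).
exact: (closureS gammaU).
Qed.

End mutually_inverse_isometries.

(** * Conjugation of geodesic-preserving maps *)

(** A geodesic at [phi b] is pulled back by [psi] to a geodesic at [b], sent by
    [g] into another one, and pushed forward by [phi].  The equation
    [psi (phi b) = b] is separate from the cancellation on [U] because [b] may
    lie on the boundary. *)
Lemma GP_conjugate (R : realType) (U V : set R[i]) (k k' : R[i] -> R[i] -> R)
    (phi psi : R[i] -> R[i]) (b : R[i]) (g : R[i] -> R[i]) :
  conformal_isometry U V k k' phi -> conformal_isometry V U k' k psi ->
  {in U, cancel phi psi} -> {in V, cancel psi phi} -> psi (phi b) = b ->
  GP U U (geodesics_at U k b) (geodesics_at U k b) g ->
  GP V V (geodesics_at V k' (phi b)) (geodesics_at V k' (phi b))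
    (phi \o g \o psi).
Proof.
move=> phiP psiP phiK psiK bK [g_holo gU g_geo]; split.
- apply: holomorphic_on_comp (isometry_holomorphic psiP)
    (isometry_image psiP) _.
  exact: holomorphic_on_comp g_holo gU (isometry_holomorphic phiP).
- move=> _ [z Vz <-] /=; apply: (isometry_image phiP).
  exists (g (psi z)) => //; apply: gU; exists (psi z) => //.
  by apply: (isometry_image psiP); exists z.
- move=> A /(geodesics_at_image psiP phiP psiK); rewrite bK => /g_geo[B BG gB].
  exists (phi @` B); first exact: (geodesics_at_image phiP psiP phiK).
  rewrite -image_comp -image_comp; exact: image_subset.
Qed.

Lemma eq_GP (R : realType) (U V : set R[i]) (FF1 FF2 : set (set R[i]))
    (f g : R[i] -> R[i]) :
  open U -> (forall A, FF1 A -> A `<=` U) -> {in U, f =1 g} ->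
  GP U V FF1 FF2 f -> GP U V FF1 FF2 g.
Proof.
move=> oU FF1U fg [f_holo fU f_geo]; split.
- exact: eq_holomorphic_on f_holo.
- by rewrite -(eq_imagel (fun z Uz => fg z (mem_set Uz))).
- move=> A AF; have [B BF fB] := f_geo A AF; exists B => //.
  by rewrite -(eq_imagel (fun z Az => fg z (mem_set (FF1U A AF z Az)))).
Qed.

Lemma geodesics_at_sub (R : realType) (U : set R[i]) (k : R[i] -> R[i] -> R)
    (b : R[i]) (A : set R[i]) : geodesics_at U k b A -> A `<=` U.
Proof.
move=> [gamma [[[_ gammaU _] _ _] -> _]].
by apply: subset_trans gammaU; apply: image_subset.
Qed.

(** * The Riemann map of a Jordan domain *)

Section riemann_map.
Context (R : realType) (Omega : set R[i]) (F : R[i] -> R[i]).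
Let D := @unit_disc R.
Let Finv := inv_on (closure D) F.
Hypotheses (F_biholo : biholomorphism D Omega F)
  (F_homeo : homeomorphism_on (closure D) (closure Omega) F)
  (Omega_open : open Omega).

Lemma riemann_map_injK : {in closure D, cancel F Finv}.
Proof. by case: F_homeo => -[_ F_inj _] _ _; exact: pinvKV. Qed.

Lemma riemann_map_surjK : {in closure Omega, cancel Finv F}.
Proof. by case: F_homeo => -[_ _ F_surj] _ _; exact: surjpK. Qed.

Lemma inv_riemann_map_image : Finv @` Omega `<=` D.
Proof.
move=> _ [z Oz <-]; case: F_biholo => -[_ _ /(_ z Oz)[w Dw <-]] _ _.
by rewrite riemann_map_injK//; exact/mem_set/subset_closure.
Qed.

(** The inverse that defines the metric of [Omega] is taken over the open disc,
    the one that reaches [a] over the closed disc. *)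
Lemma inv_riemann_mapE : {in Omega, inv_on D F =1 Finv}.
Proof.
move=> z /set_mem Oz; case: F_biholo => -[_ F_inj /(_ z Oz)[w Dw <-]] _ _.
rewrite [LHS]pinvKV ?inE// riemann_map_injK//; exact/mem_set/subset_closure.
Qed.

(** A point of the circle cannot be sent into [Omega], since it would then be
    recovered by the inverse as a point of the open disc. *)
Lemma riemann_map_isometry :
  conformal_isometry D Omega (@poincare R) (kobayashi F) F.
Proof.
case: (F_biholo) => -[DO F_inj DOs] F_holo _.
case: (F_homeo) => -[clDO _ _] F_cont _; split => //.
- by move=> _ [z Dz <-]; exact: DO.
- rewrite (boundary_open (@unit_disc_open R)) (boundary_open Omega_open).
  move=> _ [z [clDz Dz] <-]; split; first exact: clDO.
  move=> OFz; apply: Dz; rewrite -(riemann_map_injK (mem_set clDz)).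
  by apply: inv_riemann_map_image; exists (F z).
- by move=> x y Dx Dy; rewrite /kobayashi /inv_on !pinvKV ?inE.
Qed.

Lemma inv_riemann_map_isometry :
  conformal_isometry Omega D (kobayashi F) (@poincare R) Finv.
Proof.
case: (F_biholo) => -[DO F_inj DOs] _ Finv_holo.
case: (F_homeo) => -[clDO clF_inj clDOs] _ Finv_cont; split.
- exact: Finv_cont.
- exact: eq_holomorphic_on Omega_open inv_riemann_mapE Finv_holo.
- exact: inv_riemann_map_image.
- rewrite (boundary_open (@unit_disc_open R)) (boundary_open Omega_open).
  move=> _ [z [clOz Oz] <-]; split.
    by have [w clDw <-] := clDOs _ clOz; rewrite riemann_map_injK// mem_set.
  by move=> /DO; rewrite riemann_map_surjK// mem_set.
- by move=> x y Ox Oy; rewrite /kobayashi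
    (inv_riemann_mapE (mem_set Ox)) (inv_riemann_mapE (mem_set Oy)).
Qed.

End riemann_map.

Theorem theorem11 (R : realType) (Omega : set R[i]) (F : R[i] -> R[i])
    (a : R[i])
    (Omega_jordan : jordan_domain Omega)
    (F_biholo : biholomorphism (@unit_disc R) Omega F)
    (F_homeo : homeomorphism_on (closure (@unit_disc R)) (closure Omega) F)
    (a_bd : boundary Omega a) (f : R[i] -> R[i]) :
  let D := @unit_disc R in
  let Finv := inv_on (closure D) F in
  let G_Omega := geodesics_at Omega (kobayashi F) a in
  let G_D := geodesics_at D (@poincare R) (Finv a) in
  GP Omega Omega G_Omega G_Omega f <->
  (exists2 g : R[i] -> R[i], GP D D G_D G_D g &
     forall z, Omega z -> f z = F (g (Finv z))).
Proof.
move=> D Finv G_Omega G_D.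
have Omega_open := jordan_domain_open Omega_jordan.
have F_iso := riemann_map_isometry F_biholo F_homeo Omega_open.
have Finv_iso := inv_riemann_map_isometry F_biholo F_homeo Omega_open.
have DK : {in D, cancel F Finv}.
  move=> z /set_mem Dz; apply: (riemann_map_injK F_homeo).
  exact/mem_set/subset_closure.
have OmegaK : {in Omega, cancel Finv F}.
  move=> z /set_mem Oz; apply: (riemann_map_surjK F_homeo).
  exact/mem_set/subset_closure.
have aK : F (Finv a) = a.
  by apply: (riemann_map_surjK F_homeo); apply/mem_set; case: a_bd.
split=> [fGP|[g gGP fE]].
  exists (Finv \o f \o F).
    exact: (GP_conjugate Finv_iso F_iso OmegaK DK aK fGP).
  have [_ fO _] := fGP.
  by move=> z Oz /=; rewrite !OmegaK ?inE//; apply: fO; exists z.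
have bK : Finv (F (Finv a)) = Finv a by rewrite aK.
have := GP_conjugate F_iso Finv_iso DK OmegaK bK gGP; rewrite aK.
apply: eq_GP => //; first exact: geodesics_at_sub.
by move=> z /set_mem Oz; rewrite /= fE.
Qed.
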